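(* Let $(A,A^* )$ be a Zinbiel bialgebra with Zinbiel double $(\mathfrak{d},\cdot_{\mathfrak{d}})$, $\mathfrak{d}=A\oplus A^*$. Let $\{e_1,\dots,e_n\}$ be a basis of $A$ and $\{e_1^*,\dots,e_n^*\}$ the dual basis of $A^*$. Then $r=\sum_i e_i\otimes e_i^*\in A\otimes A^*\subset\mathfrak{d}\otimes\mathfrak{d}$ induces a Zinbiel algebra structure on $\mathfrak{d}^*=A^*\oplus A$ such that $(\mathfrak{d},\mathfrak{d}_r^* )$ is a quasi-triangular Zinbiel bialgebra, where the Zinbiel algebra structure $(\mathfrak{d}_r^*,\cdot_{\mathfrak{d}_r^*})$ is given by $$(\xi,x)\cdot_{\mathfrak{d}_r^*}(\eta,y)=(\xi\cdot_{A^*}\eta,\;x\circ_A y),\qquad\forall x,y\in A,\ \xi,\eta\in A^*.$$ Moreover, $(\mathfrak{d},\mathfrak{d}_r^* )$ is a factorizable Zinbiel bialgebra.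
   Context: All vector spaces are finite-dimensional over a field $\mathbb{K}$ of characteristic different from $2$. A Zinbiel algebra $(A,\circ_A)$ is a vector space with a bilinear product satisfying $x\circ_A(y\circ_A z)=(x\circ_A y+y\circ_A x)\circ_A z$. Write $x\ast_A y=x\circ_A y+y\circ_A x$, $L_x(y)=x\circ_A y$, $R_x(y)=y\circ_A x$, $\langle L_x^*\xi,y\rangle=-\langle\xi,x\circ_A y\rangle$, $\langle R_x^*\xi,y\rangle=-\langle\xi,y\circ_A x\rangle$. For a Zinbiel algebra $(A^*,\cdot_{A^*})$: $\mathcal{L}_\xi\eta=\xi\cdot_{A^*}\eta$, $\mathcal{R}_\xi\eta=\eta\cdot_{A^*}\xi$, $\xi\ast_{A^*}\eta=\xi\cdot_{A^*}\eta+\eta\cdot_{A^*}\xi$, $\langle\mathcal{L}_\xi^*x,\eta\rangle=-\langle x,\xi\cdot_{A^*}\eta\rangle$, $\langle\mathcal{R}_\xi^*x,\eta\rangle=-\langle x,\eta\cdot_{A^*}\xi\rangle$. Zinbiel bialgebra $(A,A^* )$: Zinbiel products $\circ_A$ on $A$ and $\cdot_{A^*}$ on $A^*$, dual to $\beta:A^*\to A^*\otimes A^*$ and $\alpha:A\to A\otimes A$ ($\langle\beta(\xi),x\otimes y\rangle=\langle\xi,x\circ_A y\rangle$, $\langle\alpha(x),\xi\otimes\eta\rangle=\langle x,\xi\cdot_{A^*}\eta\rangle$), with $\alpha(x\ast_A y)=(L_x\otimes\mathrm{Id})\alpha(y)+(\mathrm{Id}\otimes(L_y+R_y))\alpha(x)$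 and $\beta(\xi\ast_{A^*}\eta)=(\mathcal{L}_\xi\otimes\mathrm{Id})\beta(\eta)+(\mathrm{Id}\otimes(\mathcal{L}_\eta+\mathcal{R}_\eta))\beta(\xi)$. Zinbiel double: for a Zinbiel bialgebra $(A,A^* )$, the space $\mathfrak{d}=A\oplus A^*$ with the product $$(x,\xi)\cdot_{\mathfrak{d}}(y,\eta)=\big(x\circ_A y-(\mathcal{L}_\xi^*+\mathcal{R}_\xi^* )y+\mathcal{R}_\eta^*x,\ \xi\cdot_{A^*}\eta-(L_x^*+R_x^* )\eta+R_y^*\xi\big),$$ which is a Zinbiel algebra. Its dual is $\mathfrak{d}^*=A^*\oplus A$ with pairing $\langle(\xi,x),(y,\eta)\rangle=\langle\xi,y\rangle+\langle\eta,x\rangle$. Quasi-triangular / factorizable (for an arbitrary Zinbiel algebra $(A,\circ_A)$, to be applied to $\mathfrak{d}$): for $r=\sum_i a_i\otimes b_i\in A\otimes A$ define $r_\pm:A^*\to A$ by $\langle r_+(\xi),\eta\rangle=r(\xi,\eta)=\langle\xi,r_-(\eta)\rangle$, $I=r_+-r_-$, let $a$ be the skew-symmetric part of $r$, and $$[\![r,r]\!]=\sum_{i,j}\big(-a_i\circ_A a_j\otimes b_j\otimes b_i-b_j\otimes a_i\circ_A a_j\otimes b_i+a_i\ast_A b_j\otimes a_j\otimes b_i+a_i\otimes b_i\ast_A a_j\otimes b_j-a_i\otimes a_j\otimes b_i\ast_A b_j\big).$$ An element $s\in A\otimes A$ is $(L,L+R)$-invariant if $(L_x\otimes\mathrm{Id}-\mathrm{Id}\otimes(L_x+R_x))s=0$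 for all $x$. If $[\![r,r]\!]=0$ and $a$ is $(L,L+R)$-invariant, the map $\alpha(x)=(\mathrm{Id}\otimes(L_x+R_x)-L_x\otimes\mathrm{Id})r$ defines on $A^*$ (then denoted $A_r^*$) the product $\xi\cdot_r\eta=-(L^*_{r_+(\xi)}+R^*_{r_+(\xi)})\eta+R^*_{r_-(\eta)}\xi$, and $(A,A_r^* )$ is a Zinbiel bialgebra, called the quasi-triangular Zinbiel bialgebra induced by $r$. It is factorizable if moreover $a$ is nondegenerate, i.e. $I:A^*\to A$ is a linear isomorphism. *)

(* Defs.v *)
From HB Require Import structures.
From mathcomp Require Import all_boot all_order all_algebra.
Set Implicit Arguments.
Unset Strict Implicit.
Unset Printing Implicit Defensive.
Import GRing.Theory.
Local Open Scope ring_scope.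

Definition dualv (K : fieldType) (V : vectType K) := 'Hom(V, K^o).
HB.instance Definition _ (K : fieldType) (V : vectType K) :=
  Vector.on (dualv V).

(* For finite-dimensional V and W, the tensor product of V and W is realized
   as Hom(V^*, W), with v (x) w the map sending xi to xi(v) w; tlift_ten,
   tens_eqP and tens_decomp below give its universal property. *)
Definition tens (K : fieldType) (V W : vectType K) := 'Hom(dualv V, W).
HB.instance Definition _ (K : fieldType) (V W : vectType K) :=
  Vector.on (tens V W).

Lemma linfunP (K : fieldType) (V W : vectType K) (f : V -> W) :
  linear f -> linfun f =1 f.
Proof.
move=> lf v.
pose m := GRing.isLinear.Build K V W *:%R f lf.
pose F : {linear V -> W} := HB.pack f m.
exact: (lfunE F v).
Qed.

Section Linear.
Variables (K : fieldType) (V W : vectType K) (f : V -> W) (lf : linear f).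
Lemma lin0 : f 0 = 0.
Proof. by have:= linfunP lf 0; rewrite linear0. Qed.
Lemma linD u v : f (u + v) = f u + f v.
Proof. by rewrite -!(linfunP lf) linearD. Qed.
Lemma linB u v : f (u - v) = f u - f v.
Proof. by rewrite -!(linfunP lf) linearB. Qed.
Lemma linN u : f (- u) = - f u.
Proof. by rewrite -!(linfunP lf) linearN. Qed.
Lemma linZ a u : f (a *: u) = a *: f u.
Proof. by rewrite -!(linfunP lf) linearZ. Qed.
Lemma lin_sum I (s : seq I) (P : pred I) (F : I -> V) :
  f (\sum_(i <- s | P i) F i) = \sum_(i <- s | P i) f (F i).
Proof. by rewrite -(linfunP lf) linear_sum; apply: eq_bigr => i _; exact: linfunP. Qed.
End Linear.

Section Tensor.
Variable K : fieldType.
Implicit Types V W U : vectType K.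

Definition coordv V (i : 'I_(\dim {:V})) : dualv V :=
  linfun (coord (vbasis {:V}) i : V -> K^o).

Definition evalv V (x : V) : dualv (dualv V) :=
  linfun (fun xi : dualv V => xi x).

(* The inverse of evalv. *)
Definition unbidual V (phi : dualv (dualv V)) : V :=
  \sum_(i < \dim {:V}) (phi (coordv i) : K) *: (vbasis {:V})`_i.

Definition ten V W (v : V) (w : W) : tens V W :=
  linfun (fun xi : dualv V => (xi v : K) *: w).

(* < t , xi (x) eta > *)
Definition tpair V W (t : tens V W) (xi : dualv V) (eta : dualv W) : K :=
  eta (t xi).

(* The linear map on the tensor product induced by a bilinear map F. *)
Definition tlift V W U (F : V -> W -> U) (t : tens V W) : U :=
  \sum_(i < \dim {:V}) F (vbasis {:V})`_i (t (coordv i)).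

Definition tmap V W V' W' (f : V -> V') (g : W -> W') (t : tens V W) :
    tens V' W' :=
  tlift (fun v w => ten (f v) (g w)) t.

Definition tswap V W (t : tens V W) : tens W V :=
  tlift (fun v w => ten w v) t.

Lemma coordvE V (i : 'I_(\dim {:V})) v :
  coordv i v = coord (vbasis {:V}) i v.
Proof. by rewrite /coordv lfunE. Qed.

Lemma coordv_sum V (v : V) :
  v = \sum_(i < \dim {:V}) (coordv i v : K) *: (vbasis {:V})`_i.
Proof.
rewrite {1}(coord_vbasis (memvf v)); apply: eq_bigr => i _.
by rewrite coordvE.
Qed.

Lemma dual_sum V (xi : dualv V) :
  xi = \sum_(i < \dim {:V}) (xi (vbasis {:V})`_i : K) *: coordv i.
Proof.
apply/lfunP => v; rewrite {1}(coordv_sum v) linear_sum sum_lfunE.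
by apply: eq_bigr => i _; rewrite linearZ scale_lfunE; exact: mulrC.
Qed.

Lemma evalvE V (x : V) xi : evalv x xi = xi x.
Proof.
by rewrite /evalv linfunP // => a u v; rewrite add_lfunE scale_lfunE.
Qed.

Lemma unbidualE V (phi : dualv (dualv V)) (xi : dualv V) :
  xi (unbidual phi) = phi xi.
Proof.
rewrite [in RHS](dual_sum xi) /unbidual !linear_sum; apply: eq_bigr => i _.
by rewrite !linearZ; exact: mulrC.
Qed.

Lemma dual_inj V (v w : V) : (forall xi : dualv V, xi v = xi w) -> v = w.
Proof.
move=> h; rewrite (coordv_sum v) (coordv_sum w).
by apply: eq_bigr => i _; rewrite h.
Qed.

Lemma tenE V W (v : V) (w : W) xi : ten v w xi = (xi v : K) *: w.
Proof.
rewrite /ten linfunP // => a x y.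
by rewrite add_lfunE scale_lfunE scalerDl scalerA.
Qed.

Lemma tpair_ten V W (v : V) (w : W) xi eta :
  tpair (ten v w) xi eta = (xi v : K) * (eta w : K).
Proof. by rewrite /tpair tenE linearZ. Qed.

Lemma tens_eqP V W (t t' : tens V W) :
  (forall xi eta, tpair t xi eta = tpair t' xi eta) -> t = t'.
Proof. by move=> h; apply/lfunP => xi; apply: dual_inj => eta; exact: h. Qed.

Lemma ten_linl V W (w : W) : linear (fun v : V => ten v w).
Proof.
move=> a u v; apply/lfunP => xi.
by rewrite add_lfunE scale_lfunE !tenE linearP scalerDl scalerA.
Qed.

Lemma ten_linr V W (v : V) : linear (ten v : W -> tens V W).
Proof.
move=> a u w; apply/lfunP => xi.
rewrite add_lfunE scale_lfunE !tenE scalerDr !scalerA.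
by congr (_ *: _ + _); rewrite mulrC.
Qed.

Lemma tens_decomp V W (t : tens V W) :
  t = \sum_(i < \dim {:V}) ten (vbasis {:V})`_i (t (coordv i)).
Proof.
apply/lfunP => xi; rewrite {1}(dual_sum xi) linear_sum sum_lfunE.
by apply: eq_bigr => i _; rewrite linearZ tenE.
Qed.

Lemma tlift_linear V W U (F : V -> W -> U) :
  (forall v, linear (F v)) -> linear (tlift F).
Proof.
move=> lF a s t; rewrite /tlift scaler_sumr -big_split; apply: eq_bigr => i _.
by rewrite add_lfunE scale_lfunE /= lF.
Qed.

Lemma tlift_ten V W U (F : V -> W -> U) :
  (forall v, linear (F v)) -> (forall w, linear (F^~ w)) ->
  forall v w, tlift F (ten v w) = F v w.
Proof.
move=> lr ll v w; rewrite {2}(coordv_sum v) (lin_sum (ll w)).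
by apply: eq_bigr => i _; rewrite tenE (linZ (lr _)) (linZ (ll _)).
Qed.

Lemma tlift_sum V W U (F : V -> W -> U) :
  (forall v, linear (F v)) -> (forall w, linear (F^~ w)) ->
  forall (I : finType) (a : I -> V) (b : I -> W),
  tlift F (\sum_i ten (a i) (b i)) = \sum_i F (a i) (b i).
Proof.
move=> lr ll I a b; rewrite (lin_sum (tlift_linear lr)).
by apply: eq_bigr => i _; rewrite tlift_ten.
Qed.

Lemma tmap_ten V W V' W' (f : V -> V') (g : W -> W') :
  linear f -> linear g ->
  forall v w, tmap f g (ten v w) = ten (f v) (g w).
Proof.
move=> lf lg v w; rewrite /tmap tlift_ten // => [u|u] a x y.
  by rewrite lg ten_linr.
by rewrite lf ten_linl.
Qed.

Lemma tswapE V W (t : tens V W) xi eta :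
  tpair (tswap t) eta xi = tpair t xi eta.
Proof.
rewrite /tswap /tlift /tpair [in RHS](tens_decomp t) !sum_lfunE !linear_sum.
by apply: eq_bigr => i _; rewrite !tenE !linearZ; exact: mulrC.
Qed.

End Tensor.

Section Zinbiel.
Variable K : fieldType.
Implicit Types A : vectType K.

Definition amul A (mul : A -> A -> A) (x y : A) : A := mul x y + mul y x.

Definition zinbiel A (mul : A -> A -> A) : Prop :=
  [/\ forall x, linear (mul x),
      forall y, linear (mul^~ y)
    & forall x y z, mul x (mul y z) = mul (amul mul x y) z].

(* L_x^* and R_x^* are minus the transposes of L_x and R_x. *)
Definition Lstar A (mul : A -> A -> A) (x : A) (xi : dualv A) : dualv A :=
  linfun (fun y => - xi (mul x y)).
Definition Rstar A (mul : A -> A -> A) (x : A) (xi : dualv A) : dualv A :=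
  linfun (fun y => - xi (mul y x)).

(* The same operators for a product on A^*, acting on A = A^**. *)
Definition dLstar A (mulD : dualv A -> dualv A -> dualv A) (xi : dualv A)
  (x : A) : A := unbidual (Lstar mulD xi (evalv x)).
Definition dRstar A (mulD : dualv A -> dualv A -> dualv A) (xi : dualv A)
  (x : A) : A := unbidual (Rstar mulD xi (evalv x)).

Definition compatible A (mul : A -> A -> A) (D : A -> tens A A) : Prop :=
  forall x y, D (amul mul x y) =
    tmap (mul x) id (D y) + tmap id (amul mul y) (D x).

(* alpha and beta are uniquely determined by the two duality conditions. *)
Definition zinbiel_bialgebra A (mulA : A -> A -> A)
    (mulD : dualv A -> dualv A -> dualv A) : Prop :=
  [/\ zinbiel mulA, zinbiel mulD
    & exists (alpha : 'Hom(A, tens A A))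
             (beta : 'Hom(dualv A, tens (dualv A) (dualv A))),
      [/\ forall x xi eta, tpair (alpha x) xi eta = mulD xi eta x,
          forall xi x y,
            tpair (beta xi) (evalv x) (evalv y) = xi (mulA x y),
          compatible mulA alpha
        & compatible mulD beta]].

Definition zinbiel_double A (mulA : A -> A -> A)
    (mulD : dualv A -> dualv A -> dualv A) (p q : A * dualv A) :
    A * dualv A :=
  let: (x, xi) := p in let: (y, eta) := q in
  (mulA x y - (dLstar mulD xi y + dRstar mulD xi y) + dRstar mulD eta x,
   mulD xi eta - (Lstar mulA x eta + Rstar mulA x eta) + Rstar mulA y xi).

(* (xi, x) in A^* + A viewed in the dual of A + A^*. *)
Definition dpair A (xi : dualv A) (x : A) : dualv (A * dualv A)%type :=
  linfun (fun p : A * dualv A => xi p.1 + p.2 x).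

(* r_+ is r itself, seen as a map A^* -> A, and r_- is that of the flip. *)
Definition r_plus A (r : tens A A) : 'Hom(dualv A, A) := r.
Definition r_minus A (r : tens A A) : 'Hom(dualv A, A) := tswap r.
Definition r_I A (r : tens A A) : 'Hom(dualv A, A) := r_plus r - r_minus r.

Definition skew_part A (r : tens A A) : tens A A := 2^-1 *: (r - tswap r).

(* The (i,j)-summand of [[r,r]] for r = \sum_i a_i (x) b_i. *)
Definition ybe_term A (mul : A -> A -> A) (ai bi aj bj : A) :
    tens A (tens A A) :=
  - ten (mul ai aj) (ten bj bi) - ten bj (ten (mul ai aj) bi)
  + ten (amul mul ai bj) (ten aj bi) + ten ai (ten (amul mul bi aj) bj)
  - ten ai (ten aj (amul mul bi bj)).

(* See ybe_sum for the usual double sum. *)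
Definition ybe A (mul : A -> A -> A) (r : tens A A) : tens A (tens A A) :=
  tlift (fun ai bi => tlift (ybe_term mul ai bi) r) r.

Definition LLR_invariant A (mul : A -> A -> A) (s : tens A A) : Prop :=
  forall x, tmap (mul x) id s - tmap id (amul mul x) s = 0.

Definition cobound A (mul : A -> A -> A) (r : tens A A) (x : A) : tens A A :=
  tmap id (amul mul x) r - tmap (mul x) id r.

(* The product on A^* dual to cobound; induced_mulE gives it through r_+, r_-. *)
Definition induced_mul A (mul : A -> A -> A) (r : tens A A)
    (xi eta : dualv A) : dualv A :=
  linfun (fun x => tpair (cobound mul r x) xi eta : K^o).

Definition quasi_triangular A (mul : A -> A -> A) (r : tens A A) : Prop :=
  [/\ ybe mul r = 0, LLR_invariant mul (skew_part r)
    & zinbiel_bialgebra mul (induced_mul mul r)].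

Definition factorizable A (mul : A -> A -> A) (r : tens A A) : Prop :=
  quasi_triangular mul r /\ bijective (r_I r).

Lemma LstarE A (mul : A -> A -> A) x (xi : dualv A) y :
  (forall x, linear (mul x)) -> Lstar mul x xi y = - xi (mul x y).
Proof.
move=> lm; rewrite /Lstar linfunP // => a u v.
by rewrite lm linearP opprD scalerN.
Qed.

Lemma RstarE A (mul : A -> A -> A) x (xi : dualv A) y :
  (forall y, linear (mul^~ y)) -> Rstar mul x xi y = - xi (mul y x).
Proof.
move=> lm; rewrite /Rstar linfunP // => a u v.
by rewrite lm linearP opprD scalerN.
Qed.

Lemma dLstarE A (mulD : dualv A -> dualv A -> dualv A) xi x (eta : dualv A) :
  (forall x, linear (mulD x)) -> eta (dLstar mulD xi x) = - mulD xi eta x.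
Proof. by move=> lm; rewrite /dLstar unbidualE LstarE // evalvE. Qed.

Lemma dRstarE A (mulD : dualv A -> dualv A -> dualv A) xi x (eta : dualv A) :
  (forall y, linear (mulD^~ y)) -> eta (dRstar mulD xi x) = - mulD eta xi x.
Proof. by move=> lm; rewrite /dRstar unbidualE RstarE // evalvE. Qed.

Lemma dpairE A (xi : dualv A) (x : A) y eta :
  dpair xi x (y, eta) = xi y + eta x.
Proof.
rewrite /dpair linfunP // => a [u u'] [v v'] /=.
by rewrite linearP add_lfunE scale_lfunE scalerDr addrACA.
Qed.

Lemma dpair_bij A : bijective (fun p : dualv A * A => dpair p.1 p.2).
Proof.
pose g (phi : dualv (A * dualv A)%type) : dualv A * A :=
  (linfun (fun y : A => phi (y, 0)),
   unbidual (linfun (fun eta : dualv A => phi (0, eta)))).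
have l1 (phi : dualv (A * dualv A)%type) :
    linear (fun y : A => phi (y, 0)).
  move=> a u v; rewrite -linearP; congr (phi _).
  by rewrite -[RHS]/(a *: u + v, a *: 0 + 0) scaler0 addr0.
have l2 (phi : dualv (A * dualv A)%type) :
    linear (fun eta : dualv A => phi (0, eta)).
  move=> a u v; rewrite -linearP; congr (phi _).
  by rewrite -[RHS]/(a *: 0 + 0, a *: u + v) scaler0 addr0.
exists g => [[xi x]|phi] /=.
  congr (_, _).
    by apply/lfunP => y; rewrite linfunP // dpairE zero_lfunE addr0.
  by apply: dual_inj => eta; rewrite unbidualE linfunP // dpairE linear0 add0r.
apply/lfunP => -[y eta]; rewrite dpairE unbidualE !linfunP // -linearD.
by congr (phi _); rewrite -[LHS]/(y + 0, 0 + eta) addr0 add0r.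
Qed.

Lemma r_plusE A (r : tens A A) xi (eta : dualv A) : eta (r_plus r xi) = tpair r xi eta.
Proof. by []. Qed.

Lemma r_minusE A (r : tens A A) (xi : dualv A) eta : xi (r_minus r eta) = tpair r xi eta.
Proof. by rewrite -(tswapE r xi eta). Qed.

Lemma amul_linr A (mul : A -> A -> A) :
  (forall x, linear (mul x)) -> (forall y, linear (mul^~ y)) ->
  forall x, linear (amul mul x).
Proof.
by move=> lr ll x a u v; rewrite /amul lr ll scalerDr addrACA.
Qed.

Lemma amulC A (mul : A -> A -> A) x y : amul mul x y = amul mul y x.
Proof. exact: addrC. Qed.

Lemma tpair_tmap A (f g : A -> A) (r : tens A A) xi eta :
  linear f -> linear g ->
  tpair (tmap f g r) xi eta =
  tpair r (linfun (fun y => xi (f y))) (linfun (fun y => eta (g y))).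
Proof.
move=> lf lg; rewrite /tmap /tlift /tpair [in RHS](tens_decomp r).
rewrite !sum_lfunE !linear_sum; apply: eq_bigr => i _.
have l (h : A -> A) (z : dualv A) : linear h -> linear (fun y => z (h y)).
  by move=> lh a u v; rewrite lh linearP.
rewrite !tenE !linearZ (linfunP (l f xi lf)); congr (_ _ _).
exact/esym/(linfunP (l g eta lg)).
Qed.

Lemma coboundE A (mul : A -> A -> A) (r : tens A A) xi eta x :
  (forall x, linear (mul x)) -> (forall y, linear (mul^~ y)) ->
  tpair (cobound mul r x) xi eta =
    (- (Lstar mul (r_plus r xi) eta + Rstar mul (r_plus r xi) eta)
     + Rstar mul (r_minus r eta) xi) x.
Proof.
move=> lr ll.
have l (h : A -> A) (z : dualv A) : linear h -> linear (fun y => z (h y)).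
  by move=> lh a u v; rewrite lh linearP.
rewrite add_lfunE opp_lfunE add_lfunE LstarE // !RstarE //.
have -> : tpair (cobound mul r x) xi eta =
    tpair (tmap id (amul mul x) r) xi eta - tpair (tmap (mul x) id r) xi eta.
  by rewrite /cobound /tpair add_lfunE opp_lfunE linearB.
have lid : linear (@id A) by [].
have la := amul_linr lr ll x.
have idE (z : dualv A) : linfun (fun y => z (id y)) = z.
  by apply/lfunP => y; rewrite linfunP //; exact: (l id).
rewrite !tpair_tmap // !idE -r_plusE -r_minusE.
rewrite (linfunP (l _ _ la)) (linfunP (l _ _ (lr x))).
by rewrite /amul linearD opprD !opprK [in RHS]addrC [in LHS]addrC; congr (_ + _); rewrite addrC.
Qed.

Lemma induced_mulP A (mul : A -> A -> A) (r : tens A A) xi eta x :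
  (forall x, linear (mul x)) -> (forall y, linear (mul^~ y)) ->
  induced_mul mul r xi eta x = tpair (cobound mul r x) xi eta.
Proof.
move=> lr ll; rewrite /induced_mul linfunP // => a u v.
by rewrite !coboundE // linearP.
Qed.

Lemma induced_mulE A (mul : A -> A -> A) (r : tens A A) xi eta :
  (forall x, linear (mul x)) -> (forall y, linear (mul^~ y)) ->
  induced_mul mul r xi eta =
    - (Lstar mul (r_plus r xi) eta + Rstar mul (r_plus r xi) eta)
    + Rstar mul (r_minus r eta) xi.
Proof.
by move=> lr ll; apply/lfunP => x; rewrite induced_mulP // coboundE.
Qed.

Let lin5 (T : lmodType K) c (x1 x2 x3 x4 x5 y1 y2 y3 y4 y5 : T) :
  - (c *: x1 + y1) - (c *: x2 + y2) + (c *: x3 + y3) + (c *: x4 + y4)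
    - (c *: x5 + y5) =
  c *: (- x1 - x2 + x3 + x4 - x5) + (- y1 - y2 + y3 + y4 - y5).
Proof.
rewrite !scalerDr !scalerN !opprD.
by do 4!(rewrite [RHS]addrACA; congr (_ + _)).
Qed.

Let trilin4 A (T : vectType K) (t : A -> A -> A -> T) (m s : A -> A -> A) :
  (forall y z, linear (fun x => t x y z)) ->
  (forall x z, linear (fun y => t x y z)) ->
  (forall x y, linear (fun z => t x y z)) ->
  (forall x, linear (m x)) -> (forall y, linear (m^~ y)) ->
  (forall x, linear (s x)) -> (forall y, linear (s^~ y)) ->
  let F ai bi aj bj := - t (m ai aj) bj bi - t bj (m ai aj) bi
    + t (s ai bj) aj bi + t ai (s bi aj) bj - t ai aj (s bi bj) in
  forall ai bi aj bj,
    [/\ linear (fun x => F x bi aj bj), linear (fun x => F ai x aj bj),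
        linear (fun x => F ai bi x bj) & linear (fun x => F ai bi aj x)].
Proof.
move=> t1 t2 t3 mr ml sr sl F ai bi aj bj; rewrite /F.
split=> c u v.
- by rewrite (ml aj) (sl bj) !t1 t2 lin5.
- by rewrite (sl aj) (sl bj) t2 !t3 lin5.
- by rewrite (mr ai) (sr bi) t1 !t2 lin5.
- by rewrite (sr ai) (sr bi) !t1 t2 !t3 lin5.
Qed.

Let tlift2_sum A (T : vectType K) (F : A -> A -> A -> A -> T) :
  (forall ai bi aj bj,
    [/\ linear (fun x => F x bi aj bj), linear (fun x => F ai x aj bj),
        linear (fun x => F ai bi x bj) & linear (fun x => F ai bi aj x)]) ->
  forall (I : finType) (a b : I -> A), let r := \sum_i ten (a i) (b i) in
  tlift (fun ai bi => tlift (F ai bi) r) r =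
  \sum_i \sum_j F (a i) (b i) (a j) (b j).
Proof.
move=> lin4 I a b r.
have e ai bi : tlift (F ai bi) r = \sum_j F ai bi (a j) (b j).
  by apply: tlift_sum => z; have [_ _ ? ?] := lin4 ai bi z z.
rewrite {2}/r tlift_sum; first by apply: eq_bigr => i _; rewrite e.
  move=> x c u v; rewrite !e scaler_sumr -big_split; apply: eq_bigr => j _.
  by have [_ l _ _] := lin4 x 0 (a j) (b j); rewrite l.
move=> y c u v; rewrite !e scaler_sumr -big_split; apply: eq_bigr => j _.
by have [l _ _ _] := lin4 0 y (a j) (b j); rewrite l.
Qed.

Lemma ybe_sum A (mul : A -> A -> A) :
  (forall x, linear (mul x)) -> (forall y, linear (mul^~ y)) ->
  forall (I : finType) (a b : I -> A),
  ybe mul (\sum_i ten (a i) (b i)) =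
  \sum_i \sum_j ybe_term mul (a i) (b i) (a j) (b j).
Proof.
move=> lr ll I a b.
have la := amul_linr lr ll.
have la' y : linear (amul mul ^~ y).
  by move=> c u v; rewrite !(amulC _ _ y) la.
pose t (x y z : A) := ten x (ten y z).
have t1 y z : linear (fun x => t x y z) by exact: ten_linl.
have t2 x z : linear (fun y => t x y z).
  by move=> c u v; rewrite /t ten_linl; exact: ten_linr.
have t3 x y : linear (fun z => t x y z).
  by move=> c u v; rewrite /t ten_linr; exact: ten_linr.
exact: (tlift2_sum (trilin4 t1 t2 t3 lr ll la la')).
Qed.

End Zinbiel.

(* Main.v *)
(* On the double d = A + A^* consider the skew-symmetric form
   w((x, xi), (y, eta)) = xi(y) - eta(x). It identifies d with its dual and is
   invariant, w(u.v, s) = w(v, u*s), where u*s = u.s + s.u. Through it the Zinbiel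
   identity on d is the associativity of *, which unfolds to the Zinbiel
   identities of A and A^* and the two compatibility conditions. If P is the
   projection onto A^* and Q = 1 - P that onto A, both with isotropic image, the
   element r becomes r_+ = P and r_- = -Q, so that r_+ - r_- = 1, and the induced
   product is Pu.Pv - Qu.Qv. The remaining axioms then follow from the
   invariance of w and the associativity of *; the vanishing of [[r, r]] is the
   cyclic identity w(a, b*c) + w(b, c*a) + w(c, a*b) = 0. *)
Require Import Defs.
From mathcomp Require Import all_boot all_order all_algebra.
From mathcomp Require Import ring.
Set Implicit Arguments.
Unset Strict Implicit.
Unset Printing Implicit Defensive.
Import GRing.Theory.
Local Open Scope ring_scope.

(** * Compatibility of a coproduct, expressed through pairings *)

Section Comultiplication.
Variables (K : fieldType) (A : vectType K).
Implicit Types (mul : A -> A -> A) (mulD : dualv A -> dualv A -> dualv A).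

Lemma amul_linl mul :
  (forall x, linear (mul x)) -> (forall y, linear (mul^~ y)) ->
  forall y, linear ((amul mul)^~ y).
Proof. by move=> lr ll y a u v; rewrite !(amulC _ _ y) amul_linr. Qed.

(** By the Zinbiel identity both bracketings expand to [(x*y).z + (x*z).y + (y*z).x], where [*] is
    [amul mul]. *)
Lemma amulA mul : zinbiel mul -> associative (amul mul).
Proof.
case=> lr ll zin x y z.
rewrite [LHS]/amul {1}/amul (linD (lr x)) !zin -addrA [RHS]/amul.
by rewrite [X in _ = _ + mul z X]/amul (linD (lr z)) !zin !(amulC mul z).
Qed.

Lemma evalvK : cancel (@evalv K A) (@unbidual K A).
Proof. by move=> x; apply: dual_inj => xi; rewrite unbidualE evalvE. Qed.

Lemma unbidualK : cancel (@unbidual K A) (@evalv K A).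
Proof. by move=> phi; apply/lfunP => xi; rewrite evalvE unbidualE. Qed.

Lemma evalv_linear : linear (@evalv K A).
Proof. by move=> a u v; apply/lfunP => xi; rewrite add_lfunE scale_lfunE !evalvE linearP. Qed.

Lemma unbidual_linear : linear (@unbidual K A).
Proof.
by move=> a u v; apply: (can_inj evalvK); rewrite evalv_linear !unbidualK.
Qed.

Lemma tpair_tmap_Lstar mul (s : tens A A) x xi eta :
  (forall x, linear (mul x)) ->
  tpair (tmap (mul x) id s) xi eta = - tpair s (Lstar mul x xi) eta.
Proof.
move=> lr; rewrite tpair_tmap //.
have -> : linfun (fun y => xi (mul x y)) = - Lstar mul x xi.
  apply/lfunP => y; rewrite opp_lfunE LstarE // opprK linfunP // => a u v.
  by rewrite lr linearP.
have -> : linfun (fun y => eta (id y)) = eta.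
  by apply/lfunP => y; rewrite linfunP // => a u v; rewrite linearP.
by rewrite /tpair !linearN.
Qed.

Lemma tpair_tmap_amul mul (s : tens A A) x xi eta :
  (forall x, linear (mul x)) -> (forall y, linear (mul^~ y)) ->
  tpair (tmap id (amul mul x) s) xi eta =
  - tpair s xi (Lstar mul x eta + Rstar mul x eta).
Proof.
move=> lr ll; have la := amul_linr lr ll; rewrite tpair_tmap //.
have -> : linfun (fun y => eta (amul mul x y)) =
    - (Lstar mul x eta + Rstar mul x eta).
  apply/lfunP => y; rewrite opp_lfunE add_lfunE LstarE // RstarE //.
  rewrite linfunP => [|a u v]; last by rewrite la linearP.
  by rewrite /amul linearD opprD !opprK.
have -> : linfun (fun y => xi (id y)) = xi.
  by apply/lfunP => y; rewrite linfunP // => a u v; rewrite linearP.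
by rewrite /tpair opp_lfunE.
Qed.

(** Functionals separate tensors ([tens_eqP]), so nothing is lost by pairing; the tensors disappear
    and only the two products remain. *)
Lemma compatibleP mul mulD (D : A -> tens A A) :
  (forall x, linear (mul x)) -> (forall y, linear (mul^~ y)) ->
  (forall x xi eta, tpair (D x) xi eta = mulD xi eta x) ->
  compatible mul D <->
  forall x y xi eta, mulD xi eta (amul mul x y) =
    - mulD (Lstar mul x xi) eta y
    - mulD xi (Lstar mul y eta + Rstar mul y eta) x.
Proof.
move=> lr ll hD.
have tD (s t : tens A A) xi eta :
    tpair (s + t) xi eta = tpair s xi eta + tpair t xi eta.
  by rewrite /tpair add_lfunE linearD.
split=> h x y => [xi eta|].
  by rewrite -hD h tD tpair_tmap_Lstar // tpair_tmap_amul // !hD.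
apply: tens_eqP => xi eta.
by rewrite tD tpair_tmap_Lstar // tpair_tmap_amul // !hD h.
Qed.
End Comultiplication.

(** * Zinbiel bialgebras as scalar identities between two products *)

Section Bialgebra.
Variables (K : fieldType) (A : vectType K).
Implicit Types (mul : A -> A -> A) (mulD : dualv A -> dualv A -> dualv A).

(* compatibleP over A^*, with its bidual transported back to A. *)
Lemma compatible_dualP mul mulD (D : dualv A -> tens (dualv A) (dualv A)) :
  (forall x, linear (mulD x)) -> (forall y, linear (mulD^~ y)) ->
  (forall xi x y, tpair (D xi) (evalv x) (evalv y) = xi (mul x y)) ->
  compatible mulD D <->
  forall xi eta x y, amul mulD xi eta (mul x y) =
    - eta (mul (dLstar mulD xi x) y)
    - xi (mul x (dLstar mulD eta y + dRstar mulD eta y)) :> K.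
Proof.
move=> lr ll hD.
pose mulDD (p q : dualv (dualv A)) := evalv (mul (unbidual p) (unbidual q)).
have hDD xi p q : tpair (D xi) p q = mulDD p q xi.
  by rewrite /mulDD evalvE -hD !unbidualK.
apply: (iff_trans (compatibleP lr ll hDD)); rewrite /mulDD.
split=> h xi eta.
  move=> x y; have := h xi eta (evalv x) (evalv y).
  by rewrite !evalvE !evalvK (linD (@unbidual_linear K A)).
move=> p q; have := h xi eta (unbidual p) (unbidual q).
by rewrite !evalvE /dLstar /dRstar !unbidualK (linD (@unbidual_linear K A)).
Qed.

(** For fixed [x] and [xi], the form [f x xi] is a functional on the dual of [T], hence a vector of
    [T] by finite dimension. *)
Lemma coproductP (V T : vectType K) (f : V -> dualv T -> dualv T -> K) :
  (forall xi eta, linear (fun x => f x xi eta : K^o)) ->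
  (forall x eta, linear (fun xi => f x xi eta : K^o)) ->
  (forall x xi, linear (fun eta => f x xi eta : K^o)) ->
  exists D : 'Hom(V, tens T T), forall x xi eta, tpair (D x) xi eta = f x xi eta.
Proof.
move=> l1 l2 l3.
pose g x xi : T := unbidual (linfun (f x xi : _ -> K^o)).
have gE x xi (eta : dualv T) : eta (g x xi) = f x xi eta.
  by rewrite /g unbidualE linfunP.
have lg x : linear (g x).
  by move=> a u v; apply: dual_inj => eta; rewrite gE l2 -!gE linearP.
have lG : linear (fun x => linfun (g x) : tens T T).
  move=> a u v; apply/lfunP => xi; rewrite add_lfunE scale_lfunE !linfunP //.
  by apply: dual_inj => eta; rewrite gE l1 -!gE linearP.
by exists (linfun (fun x => linfun (g x) : tens T T)) => x xi eta;
  rewrite /tpair !linfunP.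
Qed.

(** Eliminates the coproducts, which the products determine. One direction unpacks the given
    bialgebra, the other builds the induced one on the double. *)
Lemma zinbiel_bialgebraP mul mulD :
  zinbiel_bialgebra mul mulD <->
  [/\ zinbiel mul, zinbiel mulD,
      forall x y xi eta, mulD xi eta (amul mul x y) =
        - mulD (Lstar mul x xi) eta y
        - mulD xi (Lstar mul y eta + Rstar mul y eta) x
    & forall xi eta x y, amul mulD xi eta (mul x y) =
        - eta (mul (dLstar mulD xi x) y)
        - xi (mul x (dLstar mulD eta y + dRstar mulD eta y)) :> K].
Proof.
split.
  case=> zA zD [alpha [beta [ha hb ca cb]]]; have [lr ll _] := zA.
  have [dr dl _] := zD; split=> //; first exact/(compatibleP lr ll ha).
  exact/(compatible_dualP dr dl hb).
case=> zA zD ca cb; have [lr ll _] := zA; have [dr dl _] := zD; split=> //.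
have lu := @unbidual_linear K A.
have [||| alpha ha] := @coproductP A A (fun x xi eta => mulD xi eta x).
- by move=> xi eta a u v; rewrite linearP.
- by move=> x eta a u v; rewrite dl add_lfunE scale_lfunE.
- by move=> x xi a u v; rewrite dr add_lfunE scale_lfunE.
have [||| beta hb] := @coproductP (dualv A) (dualv A)
    (fun xi p q => xi (mul (unbidual p) (unbidual q))).
- by move=> p q a u v; rewrite add_lfunE scale_lfunE.
- by move=> xi q a u v; rewrite lu ll linearP.
- by move=> xi p a u v; rewrite lu lr linearP.
exists alpha, beta; split=> //; first by move=> xi x y; rewrite hb !evalvK.
  exact/(compatibleP lr ll ha).
by apply/(compatible_dualP dr dl) => [xi x y|//]; rewrite hb !evalvK.
Qed.
End Bialgebra.

(** * The Yang-Baxter tensor evaluated on three functionals *)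

Section YangBaxter.
Variables (K : fieldType) (A : vectType K).

Lemma mul_sum (mul : A -> A -> A) (I : finType) (p q : I -> K) (u v : I -> A)
    (psi : dualv A) :
  (forall x, linear (mul x)) -> (forall y, linear (mul^~ y)) ->
  psi (mul (\sum_i p i *: u i) (\sum_j q j *: v j)) =
  \sum_i \sum_j p i * q j * psi (mul (u i) (v j)) :> K.
Proof.
move=> lr ll; rewrite (lin_sum (ll _)) linear_sum; apply: eq_bigr => i _.
rewrite (linZ (ll _)) (lin_sum (lr _)) linearZ linear_sum [LHS]mulr_sumr.
by apply: eq_bigr => j _; rewrite (linZ (lr _)) linearZ; exact: mulrA.
Qed.

(** For [r] the sum of the [a_i (x) b_i], a functional applied to a bare leg [b_i] turns the partner
    [a_i] into a value of [r_minus]; applied to a bare [a_i] it turns [b_i] into a value of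
    [r_plus]. *)
Lemma ybeE (mul : A -> A -> A) (r : tens A A) (phi psi chi : dualv A) :
  (forall x, linear (mul x)) -> (forall y, linear (mul^~ y)) ->
  tpair (ybe mul r phi) psi chi =
  - phi (mul (r_minus r chi) (r_minus r psi))
  - psi (mul (r_minus r chi) (r_minus r phi))
  + phi (amul mul (r_minus r chi) (r_plus r psi))
  + psi (amul mul (r_plus r phi) (r_minus r chi))
  - chi (amul mul (r_plus r phi) (r_plus r psi)) :> K.
Proof.
move=> lr ll.
have la := amul_linr lr ll; have la' := amul_linl lr ll.
pose a (i : 'I_(\dim {:A})) := (vbasis {:A})`_i.
pose b (i : 'I_(\dim {:A})) := r (coordv i).
have defr : r = \sum_i ten (a i) (b i) by exact: tens_decomp.
have rp xi : r_plus r xi = \sum_i (xi (a i) : K) *: b i.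
  by rewrite /r_plus defr sum_lfunE; apply: eq_bigr => i _; rewrite tenE.
have rm xi : r_minus r xi = \sum_i (xi (b i) : K) *: a i.
  apply: dual_inj => eta; rewrite r_minusE /tpair defr sum_lfunE !linear_sum.
  by apply: eq_bigr => i _; rewrite tenE !linearZ; exact: mulrC.
rewrite !rp !rm !mul_sum // {1}defr ybe_sum // sum_lfunE /tpair sum_lfunE linear_sum.
rewrite -!sumrN -!big_split; apply: eq_bigr => i _ /=.
rewrite sum_lfunE sum_lfunE linear_sum -!sumrN -!big_split.
apply: eq_bigr => j _ /=; rewrite /ybe_term.
(* With [amul mul] made opaque, its values are atoms for [ring]. *)
move: (amul mul) => am; rewrite !(add_lfunE, opp_lfunE) !tenE.
rewrite !scale_lfunE !tenE !linearD !linearN !linearZ /=.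
have sc (x y : K) : x *: (y : K^o) = x * y by [].
rewrite !sc; ring.
Qed.
End YangBaxter.

(** * Splitting by isotropic subalgebras under an invariant skew form *)

Section ManinTriple.
Variables (K : fieldType) (D : vectType K) (mul : D -> D -> D).
Variables (flat : D -> dualv D) (P : D -> D) (r : tens D D).
Let Q u := u - P u.
Let om u v : K := flat u v.
Hypothesis zin : zinbiel mul.
Hypothesis flat_lin : linear flat.
Hypothesis flat_surj : forall phi, exists u, phi = flat u.
Hypothesis flat_skew : forall u v, flat u v = - flat v u.
Hypothesis flat_inv : forall u v w, flat (mul u v) w = flat v (amul mul u w).
Hypothesis P_lin : linear P.
Hypothesis P_isotropic : forall u v, flat (P u) (P v) = 0.
Hypothesis Q_isotropic : forall u v, flat (Q u) (Q v) = 0.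
Hypothesis P_mul : forall u v, P (mul (P u) (P v)) = mul (P u) (P v).
Hypothesis Q_mul : forall u v, P (mul (Q u) (Q v)) = 0.
Hypothesis rE : forall u, r (flat u) = P u.

Let lr : forall x, linear (mul x). Proof. by case: zin. Qed.
Let ll : forall y, linear (mul^~ y). Proof. by case: zin. Qed.
Let la := amul_linr lr ll.
Let la' := amul_linl lr ll.

Let omDl u v w : om (u + v) w = om u w + om v w.
Proof. by rewrite /om (linD flat_lin) add_lfunE. Qed.
Let omNl u w : om (- u) w = - om u w.
Proof. by rewrite /om (linN flat_lin) opp_lfunE. Qed.
Let omDr u v w : om u (v + w) = om u v + om u w.
Proof. by rewrite /om linearD. Qed.
Let omNr u v : om u (- v) = - om u v.
Proof. by rewrite /om linearN. Qed.
Let omBl u v w : om (u - v) w = om u w - om v w.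
Proof. by rewrite omDl omNl. Qed.
Let omBr u v w : om u (v - w) = om u v - om u w.
Proof. by rewrite omDr omNr. Qed.
Let omC u v : om u v = - om v u.
Proof. exact: flat_skew. Qed.
Let om_inv u v w : om (mul u v) w = om v (amul mul u w).
Proof. exact: flat_inv. Qed.

(** Every functional is some [om w], and functionals separate vectors. *)
Let om_inj u v : (forall w, om u w = om v w) -> u = v.
Proof.
move=> h; apply: dual_inj => phi; have [w ->] := flat_surj phi.
by rewrite -/(om w u) -/(om w v) omC h -omC.
Qed.

Let PQ u : u = P u + Q u.
Proof. by rewrite addrC subrK. Qed.

(** Invariance gives [om v (u*w)], which is symmetric in [u] and [w]. *)
Let om_sym u v w : om (mul u v) w = om (mul w v) u.
Proof. by rewrite !om_inv amulC. Qed.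

Let om_amul u v w : om (amul mul u v) w = - om (mul u w) v.
Proof. by rewrite om_inv omC. Qed.

(** By isotropy both sides equal [om (P u) (Q v)]: the two projections are adjoint to each other. *)
Let omP u v : om (P u) v = om u (Q v).
Proof.
rewrite -{1}(subrK (P v) v) omDr [om (P u) (P v)]P_isotropic addr0.
by rewrite -{2}(subrK (P u) u) omDl [om (u - _) _]Q_isotropic add0r.
Qed.

Let omQ u v : om (Q u) v = om u (P v).
Proof. by rewrite omC [in RHS]omC omP. Qed.

(** [r_minus] is the transpose of [r_plus]; the adjoint of [P] is [Q], and the skewness of [om]
    supplies the sign. *)
Let r_minus_flat u : r_minus r (flat u) = - Q u.
Proof.
apply: om_inj => w; rewrite omNl omQ omC; congr (- _).
by rewrite [LHS]r_minusE /tpair rE.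
Qed.

Let ind := induced_mul mul r.

Let Lstar_flat x u : Lstar mul x (flat u) = - flat (amul mul x u).
Proof.
apply/lfunP => y; rewrite LstarE // opp_lfunE -/(om u (mul x y)).
by rewrite -/(om (amul mul x u) y) om_amul omC !opprK.
Qed.

Let Rstar_flat x u : Rstar mul x (flat u) = flat (mul u x).
Proof.
apply/lfunP => y; rewrite RstarE // -/(om u (mul y x)).
by rewrite -/(om (mul u x) y) om_sym omC !opprK.
Qed.

Let LRstar_flat x u :
  Lstar mul x (flat u) + Rstar mul x (flat u) = - flat (mul x u).
Proof.
rewrite Lstar_flat Rstar_flat /amul (linD flat_lin) opprD.
by rewrite -addrA addNr addr0.
Qed.

Let ind0 u v : ind (flat u) (flat v) = flat (mul (P u) v - mul u (Q v)).
Proof.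
rewrite /ind induced_mulE // /r_plus rE r_minus_flat LRstar_flat Rstar_flat opprK.
by rewrite (linN (lr _)) -(linD flat_lin).
Qed.

(** In [Pu.v - u.Qv], splitting [v] in the first term and [u] in the second produces the mixed
    product [Pu.Qv] twice, with opposite signs. *)
Lemma induced_mul_flat u v :
  induced_mul mul r (flat u) (flat v) =
  flat (mul (P u) (P v) - mul (u - P u) (v - P v)).
Proof.
rewrite -/ind ind0; congr flat.
rewrite -/(Q u) -/(Q v) {1}(PQ v) {2}(PQ u) (linD (lr _)) (linD (ll _)).
by rewrite addrKA.
Qed.

Let indE u v :
  ind (flat u) (flat v) = flat (mul (P u) (P v) - mul (Q u) (Q v)).
Proof. exact: induced_mul_flat. Qed.

Let Q_lin : linear Q.
Proof. by move=> a u v; rewrite /Q P_lin opprD addrACA -scalerBr. Qed.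

Let Q_D u v : Q (u + v) = Q u + Q v.
Proof. by rewrite /Q (linD P_lin) opprD addrACA. Qed.

(** With [v] alone in one slot of [om], nondegeneracy lets the dual operators of [ind] be read
    off. *)
Let ind_eval u v x :
  ind (flat u) (flat v) x = om v (amul mul (P u) x - P (amul mul u x)) :> K.
Proof.
rewrite ind0 -[LHS]/(om _ _) omBl !om_inv omBr.
by rewrite [om (Q v) _]omQ.
Qed.

(** The images of [P] and [Q] are subalgebras, and [ind] is their direct sum with the product on the
    second negated. The Zinbiel identity is quadratic in the product, so it survives the sign. *)
Let zin_ind : zinbiel ind.
Proof.
have indlr xi : linear (ind xi).
  have [u ->] := flat_surj xi => a p q.
  have [v ->] := flat_surj p; have [w ->] := flat_surj q.
  rewrite -flat_lin !indE -flat_lin; congr flat.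
  by rewrite P_lin Q_lin !lr opprD addrACA -scalerBr.
have indll xi : linear (ind^~ xi).
  have [u ->] := flat_surj xi => a p q.
  have [v ->] := flat_surj p; have [w ->] := flat_surj q.
  rewrite -flat_lin !indE -flat_lin; congr flat.
  by rewrite P_lin Q_lin !ll opprD addrACA -scalerBr.
have [_ _ z] := zin; split=> // x y t.
have [u ->] := flat_surj x; have [v ->] := flat_surj y.
have [w ->] := flat_surj t.

have Pm p q : P (mul (P p) (P q) - mul (Q p) (Q q)) = mul (P p) (P q).
  by rewrite (linB P_lin) P_mul Q_mul subr0.
have Qm p q : Q (mul (P p) (P q) - mul (Q p) (Q q)) = - mul (Q p) (Q q).
  by rewrite /Q Pm addrAC subrr add0r.
rewrite /amul !indE -(linD flat_lin) !indE; congr flat.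
rewrite Pm Qm (linD P_lin) Q_D !Pm !Qm z -opprD (linN (lr _)) (linN (ll _)) z.
by rewrite !opprK.
Qed.


Let dLstar_flat u x :
  dLstar ind (flat u) x = P (amul mul u x) - amul mul (P u) x.
Proof.
have [indr _ _] := zin_ind.
apply: dual_inj => xi; have [v ->] := flat_surj xi.
by rewrite dLstarE // ind_eval -[RHS]/(om v _) -omNr opprB.
Qed.

Let dRstar_flat u x : dRstar ind (flat u) x = Q (mul x u) - mul x (Q u).
Proof.
have [_ indl _] := zin_ind.
apply: dual_inj => xi; have [v ->] := flat_surj xi.
rewrite dRstarE // ind_eval -[RHS]/(om v _) omBr [RHS]omBr.
rewrite -omQ !(amulC _ _ x) -!om_inv -omQ !(omC _ v).
by rewrite opprB opprK addrC.
Qed.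

Let dLRstar_flat u x :
  dLstar ind (flat u) x + dRstar ind (flat u) x = P (mul u x) - mul (P u) x.
Proof.
rewrite dLstar_flat dRstar_flat {1}/amul (linD P_lin) /amul [Q u]/Q (linB (lr _)).
rewrite {1}/Q !opprD !opprK.
rewrite [X in _ + X]addrACA subrr add0r.
by rewrite [LHS]addrACA addrK addrNK.
Qed.

(* Both compatibility conditions reduce to associativity of amul mul. *)
Let ind_bialgebra : zinbiel_bialgebra mul ind.
Proof.
have mulA := amulA zin; have mulC := amulC mul.
have [indr indl _] := zin_ind.
apply/zinbiel_bialgebraP; split=> //.
- move=> x y xi eta.
  have [u ->] := flat_surj xi; have [v ->] := flat_surj eta.
  rewrite Lstar_flat LRstar_flat -!(linN flat_lin) !ind_eval omNl om_inv.
  rewrite (linN P_lin) !(linN (la' _)) (linN P_lin) (linB (la _)) !omBr !omNr.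
  have -> : amul mul (amul mul x u) y = amul mul u (amul mul x y).
    by rewrite (mulC x) mulA.
  have -> : amul mul y (amul mul (P u) x) = amul mul (P u) (amul mul x y).
    by rewrite mulC mulA.
  rewrite (mulC y (P _)) (mulC u x); ring.
- move=> xi eta x y.
  have [u ->] := flat_surj xi; have [v ->] := flat_surj eta.
  rewrite dLstar_flat dLRstar_flat {1}/amul !indE -(linD flat_lin).
  have omy a b : flat a (mul b y) = - om y (amul mul b a).
    by rewrite -[LHS]/(om _ _) omC om_inv.
  have omx s : flat u (mul x s) = - om s (amul mul x u).
    by rewrite -[LHS]/(om _ _) omC om_inv.
  rewrite !omx -[X in X = _]/(om _ (mul x y)) [LHS]omC om_inv omy omBl omP !om_inv.
  (* Again the mixed products [Pu*Qv] cancel, leaving one projection per term, so that associativity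
     can move [x] to the front everywhere. *)
  have -> : mul (P u) (P v) - mul (Q u) (Q v) +
      (mul (P v) (P u) - mul (Q v) (Q u)) = amul mul (P u) v - amul mul u (Q v).
    rewrite addrACA -opprD -/(amul mul (P u) (P v)) -/(amul mul (Q u) (Q v)).
    by rewrite {3}(PQ v) {4}(PQ u) (linD (la _)) (linD (la' _)) addrKA.
  rewrite (mulC x u) /Q !(linB (la _)) !(linB (la' _)) !omBr.
  have -> : amul mul (amul mul (P u) x) v = amul mul x (amul mul (P u) v).
    by rewrite (mulC _ x) mulA.
  have -> : amul mul (P v) (amul mul u x) = amul mul x (amul mul u (P v)).
    by rewrite mulC (mulC u) -mulA.
  have -> : amul mul v (amul mul u x) = amul mul x (amul mul u v).
    by rewrite mulC (mulC u) -mulA.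
  rewrite (mulC v (P _)); ring.
Qed.

(** Since [P + Q = 1], the map [r_I r] is inverse to [flat], which gives the nondegeneracy in
    factorizability. *)
Let r_I_flat u : r_I r (flat u) = u.
Proof.
by rewrite /r_I add_lfunE opp_lfunE /r_plus rE r_minus_flat opprK -PQ.
Qed.

Lemma manin_triple_factorizable : factorizable mul r.
Proof.
split; last first.
  exists flat => [phi|u]; last exact: r_I_flat.
  by have [u ->] := flat_surj phi; rewrite r_I_flat.
split; last exact: ind_bialgebra.
- have cyc a b c : om a (amul mul b c) + om b (amul mul c a) +
      om c (amul mul a b) = 0.
    rewrite -!om_inv om_sym addrAC [X in X + _]addrC -omDl.
    by rewrite -/(amul mul a c) om_amul om_sym addNr.
  apply/lfunP => phi; apply: tens_eqP => psi chi.
  have [u ->] := flat_surj phi; have [v ->] := flat_surj psi.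
  have [w ->] := flat_surj chi.
  rewrite ybeE // /r_plus !rE !r_minus_flat zero_lfunE /tpair zero_lfunE linear0.
  (* The image of [P] is an isotropic subalgebra, so only [Q a] pairs with products taken in it;
     [hQ] uses the closure of the image of [Q] in the same way. *)
  have omPP a b c : om a (amul mul (P b) (P c)) = om (Q a) (amul mul (P b) (P c)).
    by rewrite omQ /amul (linD P_lin) !P_mul.
  have hQ a b c : om a (mul (Q b) (Q c)) = - om (Q c) (amul mul (Q b) (P a)).
    by rewrite -om_inv [om _ (P a)]omC opprK omP /Q Q_mul subr0.
  have split_om a b : om a b = om (P a) b + om (Q a) b by rewrite -omDl -PQ.
  rewrite -[LHS]/(- om u (mul (- Q w) (- Q v)) - om v (mul (- Q w) (- Q u))
    + om u (amul mul (- Q w) (P v)) + om v (amul mul (P u) (- Q w))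
    - om w (amul mul (P u) (P v))).
  rewrite (linN (la _)) (linN (la' _)) !(linN (lr _)) !(linN (ll _)).
  rewrite !opprK !omNr !hQ [om w _]omPP.
  rewrite (split_om u (amul mul _ _)) (split_om v (amul mul _ _)).
  (* Splitting [u] and [v] cancels their [Q] parts against the terms from [hQ]; what remains is
     minus this cyclic sum. *)
  have := cyc (P u) (Q w) (P v).
  rewrite (amulC _ (P v) (P u)) (amulC _ (Q w) (P u)) => /eqP.
  rewrite -oppr_eq0 => /eqP <-; ring.
- move=> x; apply: tens_eqP => phi psi.
  rewrite /tpair zero_lfunE linear0 add_lfunE opp_lfunE linearB.
  rewrite -![X in X - _]/(tpair _ _ _) -![X in _ - X]/(tpair _ _ _).
  rewrite tpair_tmap_Lstar // tpair_tmap_amul //.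
  have [u ->] := flat_surj phi; have [v ->] := flat_surj psi.
  (* The skew part is half of [r_I r], so its invariance is that of [om]. *)
  have skew_flat a : skew_part r (flat a) = 2^-1 *: a.
    by rewrite /skew_part scale_lfunE -[_ - _]/(r_I r) r_I_flat.
  rewrite Lstar_flat LRstar_flat -!(linN flat_lin) /tpair !skew_flat !linearZ.
  rewrite -[LHS]/(- (2^-1 * om v (- amul mul x u)) -
    - (2^-1 * om (- mul x v) u)).
  by rewrite omNl omNr om_inv subrr.
Qed.
End ManinTriple.

(** * The Zinbiel double and its invariant skew form *)

Section Double.
Variables (K : fieldType) (A : vectType K).
Variables (mulA : A -> A -> A) (mulD : dualv A -> dualv A -> dualv A).

(** The skew form in curried shape, so that it is also the identification of the double with its
    dual. *)
Definition dform (p : A * dualv A) : dualv (A * dualv A)%type :=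
  dpair p.2 (- p.1).

Lemma dformE p q : dform p q = p.2 q.1 - q.2 p.1 :> K.
Proof. by case: p q => [x xi] [y eta]; rewrite dpairE linearN. Qed.

Lemma dform_linear : linear dform.
Proof.
move=> a p q; apply/lfunP => s; rewrite add_lfunE scale_lfunE !dformE /=.
rewrite add_lfunE scale_lfunE linearP scalerBr opprD addrACA.
by congr (_ + _); rewrite linearN.
Qed.

Lemma dform_surj phi : exists p, phi = dform p.
Proof.
have [f _ fK] := dpair_bij A; rewrite -(fK phi).
by exists (- (f phi).2, (f phi).1); rewrite /dform opprK.
Qed.

Lemma dform_skew p q : dform p q = - dform q p.
Proof. by rewrite !dformE opprB. Qed.

(** Serves as extensionality: equations in the double are checked after pairing, where the dual
    operators become scalar evaluations. *)
Lemma dform_inj : injective dform.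
Proof.
move=> p q h; apply: dual_inj => phi; have [s ->] := dform_surj phi.
by rewrite dform_skew h -dform_skew.
Qed.

Hypothesis hA : zinbiel_bialgebra mulA mulD.
Let mul := zinbiel_double mulA mulD.

Let ar : forall x, linear (mulA x). Proof. by case: hA => -[]. Qed.
Let al : forall y, linear (mulA^~ y). Proof. by case: hA => -[]. Qed.
Let dr : forall x, linear (mulD x). Proof. by case: hA => _ []. Qed.
Let dl : forall y, linear (mulD^~ y). Proof. by case: hA => _ []. Qed.

Let fD (f : dualv A) a b : f (a + b) = f a + f b. Proof. exact: linearD. Qed.
Let fN (f : dualv A) a : f (- a) = - f a. Proof. exact: linearN. Qed.

Let mul_form x xi y eta p : dform (mul (x, xi) (y, eta)) p =
  mulD xi eta p.1 + eta (amul mulA x p.1) - xi (mulA p.1 y)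
  - (p.2 (mulA x y) + amul mulD xi p.2 y - mulD p.2 eta x) :> K.
Proof.
rewrite dformE /= !add_lfunE !opp_lfunE !add_lfunE LstarE // !RstarE //.
case: p => z zeta /=; rewrite /amul !(fD, fN) !dLstarE // !dRstarE // ?fD ?add_lfunE.
ring.
Qed.

(** The [Rstar] and [dRstar] terms cancel under symmetrization. *)
Let amul_double x xi y eta : amul mul (x, xi) (y, eta) =
  (amul mulA x y - dLstar mulD xi y - dLstar mulD eta x,
   amul mulD xi eta - Lstar mulA x eta - Lstar mulA y xi).
Proof.
apply: dform_inj; apply/lfunP => -[z zeta].
rewrite {1}/amul (linD dform_linear) add_lfunE !mul_form dformE /= /amul.
rewrite !add_lfunE !opp_lfunE !LstarE // !(fD, fN) !dLstarE //.
ring.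
Qed.

Lemma dform_inv u v w : dform (mul u v) w = dform v (amul mul u w).
Proof.
case: u v w => [x xi] [y eta] [z zeta].
rewrite mul_form amul_double dformE /= /amul.
rewrite !add_lfunE !opp_lfunE !LstarE // !(fD, fN) !dLstarE //.
ring.
Qed.

Let mul_sym u v w : dform (mul u v) w = dform (mul w v) u.
Proof. by rewrite !dform_inv amulC. Qed.

Let mulr : forall u, linear (mul u).
Proof.
move=> u a v w; apply: dform_inj; apply/lfunP => s.
by rewrite dform_inv !dform_linear !add_lfunE !scale_lfunE !dform_inv.
Qed.

Let mull : forall u, linear (mul^~ u).
Proof.
move=> u a v w; apply: dform_inj; apply/lfunP => s.
by rewrite mul_sym linearP dform_linear add_lfunE scale_lfunE !(mul_sym _ _ s).
Qed.

(* By invariance, the Zinbiel identity of the double is the associativity of its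
   commutative product *: dform (v.w) (u*s) is symmetric in v and s. *)
Lemma zinbiel_double_zinbiel : zinbiel mul.
Proof.
split=> // u v w; apply: dform_inj; apply/lfunP => s.
rewrite dform_inv [RHS]mul_sym.
case: u v w s => [x xi] [y eta] [t tau] [z zeta].
rewrite !amul_double !mul_form /=.
have [zA zD cA cD] := (iffLR (zinbiel_bialgebraP _ _) hA).
have asA := amulA zA; have asD := amulA zD.
case: zA zD => _ _ zA [_ _ zD].
have amr := amul_linr ar al; have aml := amul_linl ar al.
have dmr := amul_linr dr dl; have dml := amul_linl dr dl.
have fB (f : dualv A) a b : f (a - b) = f a - f b by exact: linearB.
have dB (f g : dualv A) a : (f - g) a = f a - g a.
  by rewrite add_lfunE opp_lfunE.
rewrite ?(linB (amr _)) ?(linB (aml _)) ?(linB (dmr _)) ?(linB (dml _)).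
rewrite ?(linB (ar _)) ?(linB (al _)) ?(linB (dr _)) ?(linB (dl _)).
rewrite !(fB, dB).
rewrite !LstarE // !dLstarE //.
(* [gA] and [gD] are the compatibility conditions oriented as rewrite rules: each trades a [dLstar]
   nested in a product of [A] for an [Lstar] nested in a product of the dual. *)
have gA a b (f g : dualv A) : g (amul mulA b (dLstar mulD f a)) =
    - mulD f g (amul mulA a b) - mulD (Lstar mulA a f) g b.
  have e h : mulD f h a = - h (dLstar mulD f a) by rewrite dLstarE // opprK.
  rewrite cA [mulD f _ _]e add_lfunE LstarE // RstarE // /amul fD.
  ring.
have gD (f g : dualv A) a b : g (mulA (dLstar mulD f a) b) =
    - amul mulD f g (mulA a b) - amul mulD g (Lstar mulA a f) b.
  have e h : f (mulA a h) = - Lstar mulA a f h by rewrite LstarE // opprK.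
  rewrite cD (linD (ar _)) fD !e dLstarE // dRstarE // /amul add_lfunE.
  ring.
rewrite !gA !gD !zA !zD.
rewrite !(amulC mulD zeta eta) !(amulC mulA z y).
have -> : amul mulA z (amul mulA x y) = amul mulA y (amul mulA x z).
  by rewrite (amulC _ z) (amulC _ x y) -asA.
have -> : amul mulD zeta (amul mulD xi eta) = amul mulD eta (amul mulD xi zeta).
  by rewrite (amulC _ zeta) (amulC _ xi eta) -asD.
ring.
Qed.

Lemma double_mul_primal x y : mul (x, 0) (y, 0) = (mulA x y, 0).
Proof.
apply: dform_inj; apply/lfunP => -[z zeta]; rewrite mul_form dformE /=.
by rewrite /amul ?(lin0 (dr _)) ?(lin0 (dl _)) !(zero_lfunE, addr0, subr0, sub0r, oppr0).
Qed.

Lemma double_mul_dual xi eta : mul (0, xi) (0, eta) = (0, mulD xi eta).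
Proof.
apply: dform_inj; apply/lfunP => -[z zeta]; rewrite mul_form dformE /=.
have f0 (f : dualv A) : f 0 = 0 by exact: linear0.
rewrite /amul !(lin0 (ar _)) !(lin0 (al _)) !addr0 !f0.
by rewrite !(addr0, subr0, sub0r, oppr0).
Qed.
End Double.

(** * The canonical element of the double *)

(** It suffices to compare values on the basis [e]. This makes the canonical element act as the
    projection onto the dual summand. *)
Lemma dual_basis_sum (K : fieldType) (A : vectType K) (n : nat) (e : n.-tuple A)
    (es : n.-tuple (dualv A)) (xi : dualv A) :
  basis_of {:A} e -> (forall i j : 'I_n, es`_i e`_j = (i == j)%:R) ->
  \sum_(i < n) (xi e`_i : K) *: es`_i = xi.
Proof.
move=> he hes; set f := \sum_(i < n) _.
have fe (j : 'I_n) : f e`_j = xi e`_j.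
  rewrite sum_lfunE (bigD1 j) //= big1 ?addr0 => [|i ne].
    by rewrite scale_lfunE hes eqxx; exact: mulr1.
  by rewrite scale_lfunE hes (negbTE ne); exact: mulr0.
apply/lfunP => x; rewrite (coord_basis he (memvf x)) !linear_sum.
by apply: eq_bigr => j _; rewrite !linearZ; congr (_ *: _); exact: fe.
Qed.

Unset Implicit Arguments.

Theorem theorem4p20 (K : fieldType) (hK : 2%N \notin [pchar K])
    (A : vectType K)
    (mulA : A -> A -> A) (mulD : dualv A -> dualv A -> dualv A)
    (hA : zinbiel_bialgebra mulA mulD)
    (n : nat) (e : n.-tuple A) (es : n.-tuple (dualv A))
    (he : basis_of {:A} e)
    (hes : forall i j : 'I_n, es`_i e`_j = (i == j)%:R) :
  let muld := zinbiel_double mulA mulD in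
  let r : tens (A * dualv A)%type (A * dualv A)%type :=
    \sum_(i < n) ten (e`_i, 0) (0, es`_i) in
  [/\ quasi_triangular muld r,
      forall (xi eta : dualv A) (x y : A),
        induced_mul muld r (dpair xi x) (dpair eta y) =
        dpair (mulD xi eta) (mulA x y)
    & factorizable muld r].
Proof.
move=> muld r.
(* Projection onto the dual summand; its complement [p - P p] projects onto [A]. *)
pose P (p : A * dualv A) : A * dualv A := (0, p.2).
have PE p : p - P p = (p.1, 0).
  by case: p => x xi; rewrite -[LHS]/(x - 0, xi - xi) subr0 subrr.
have P_lin : linear P.
  by move=> a u v; rewrite -[RHS]/(a *: 0 + 0, a *: u.2 + v.2) scaler0 addr0.
have P_iso u v : dform (P u) (P v) = 0.
  have f0 (f : dualv A) : f 0 = 0 by exact: linear0.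
  by apply: (etrans (dformE _ _)); rewrite /= !f0 subr0.
have Q_iso u v : dform (u - P u) (v - P v) = 0.
  by rewrite !PE; apply: (etrans (dformE _ _)); rewrite /= !zero_lfunE subr0.
have P_mul u v : P (muld (P u) (P v)) = muld (P u) (P v).
  by rewrite /muld double_mul_dual.
have Q_mul u v : P (muld (u - P u) (v - P v)) = 0.
  by rewrite !PE /muld double_mul_primal.
have rE u : r (dform u) = P u.
  have inr_lin : linear (fun xi : dualv A => (0, xi) : A * dualv A).
    by move=> a xi eta; rewrite -[RHS]/(a *: 0 + 0, a *: xi + eta) scaler0 addr0.
  rewrite /P -(dual_basis_sum u.2 he hes) (lin_sum inr_lin) /r sum_lfunE.
  apply: eq_bigr => i _; rewrite tenE (linZ inr_lin); congr (_ *: _).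
  by rewrite dformE /= zero_lfunE subr0.
have zin := zinbiel_double_zinbiel hA.
have inv := dform_inv hA.
have fact := manin_triple_factorizable zin (@dform_linear _ A) (@dform_surj _ A)
  (@dform_skew _ A) inv P_lin P_iso Q_iso P_mul Q_mul rE.
split=> //; first by case: fact.
move=> xi eta x y.
(* The sign in [dform] absorbs the minus of the induced product on [A]: [(-x).(-y) = x.y] enters
   negated, and [dpair] negates it back. *)
have dp z (zeta : dualv A) : dpair zeta z = dform (- z, zeta) by rewrite /dform opprK.
rewrite !dp (induced_mul_flat zin (@dform_linear _ A) (@dform_surj _ A)
  (@dform_skew _ A) inv P_iso Q_iso rE) !PE /muld.
rewrite (double_mul_dual hA) (double_mul_primal hA); have [[ar al _] _ _] := hA.
rewrite (linN (ar _)) (linN (al _)) opprK; congr dform.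
by rewrite -[LHS]/(0 - _, _ - 0) sub0r subr0.
Qed.
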